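(* Let $m,n$ be non-negative integers. For a fixed partition $\lambda$ of length at most $m+n$, there is a 1-to-1 correspondence between $\mathfrak{P}(n,m)$ and the set $\{(\mu,\nu):\mu\star_{m,n}\nu=\lambda\}$ of all pairs of partitions (of length at most $m$ and $n$, respectively) whose $(m,n)$-overlap is $\lambda$, given by $$\pi\mapsto\left(\mu(\pi)+\lambda_{V(\pi)},\ \nu(\pi)'+\lambda_{H(\pi)}\right).$$ Moreover, $\varepsilon_{m,n}\left(\mu(\pi)+\lambda_{V(\pi)},\,\nu(\pi)'+\lambda_{H(\pi)}\right)=(-1)^{|\nu(\pi)|}=(-1)^{mn-|\mu(\pi)|}$.
   Context: A partition is a non-increasing sequence of non-negative integers; partitions differing only by trailing zeros are equal; its length is the number of positive parts, its size $|\lambda|$ is the sum of its parts, and $\lambda'$ is its conjugate. When used as a sequence of prescribed length, a partition is padded with zeros. Sums of sequences are elementwise, and the union $\mathcal{A}\cup\mathcal{B}$ of two sequences is obtained by appending $\mathcal{B}$ to $\mathcal{A}$. For a subsequence $K$ of $[N]=(1,\dots,N)$ and a sequence $\lambda$ of length $N$, $\lambda_K=(\lambda_{K_1},\dots,\lambda_{K_{l(K)}})$. $\langle n^m\rangle=(n,\dots,n)$ ($m$ entries); $\mu\subset\langle n^m\rangle$ denotes containment of Ferrers diagrams. Staircase walks: $\mathfrak{P}(n,m)$ is the set of all lattice walks using only unit west and south steps from the top-right to the bottom-left corner of a rectangle of width $n$ and height $m$. For $\pi\in\mathfrak{P}(n,m)$, $\mu(\pi)\subset\langle n^m\rangle$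 is the partition whose Ferrers diagram (rows left-justified, from top to bottom) consists of the boxes above $\pi$, and $\nu(\pi)\subset\langle n^m\rangle$ is the partition whose Ferrers diagram, rotated by 180 degrees, consists of the boxes below $\pi$ (so $\nu(\pi)_i=n-\mu(\pi)_{m+1-i}$ for $1\le i\le m$). $V(\pi)$ and $H(\pi)$ are the increasing sequences of the times (positions in $1,\dots,m+n$) of the vertical and horizontal steps of $\pi$, respectively. Overlap: $\rho_n=(n-1,\dots,1,0)$ ($\rho_0$ is empty). For partitions $\mu,\nu$ of length at most $m$ and $n$, respectively, the $(m,n)$-overlap $\mu\star_{m,n}\nu$ is the partition (of length at most $m+n$) such that $\mu\star_{m,n}\nu+\rho_{m+n}$ equals $(\mu+\rho_m)\cup(\nu+\rho_n)$ up to reordering, if it exists; otherwise $\mu\star_{m,n}\nu=\infty$, a symbol that is not a partition. If the overlap is a partition, $\varepsilon_{m,n}(\mu,\nu)$ is the sign of the permutation sorting $(\mu+\rho_m)\cup(\nu+\rho_n)$ into the strictly decreasing sequence $\mu\star_{m,n}\nu+\rho_{m+n}$; otherwise $\varepsilon_{m,n}(\mu,\nu)=1$. *)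

(* Defs.v *)
From mathcomp Require Import all_boot all_order all_fingroup all_algebra.
From mathcomp Require Import boolp classical_sets functions.

Set Implicit Arguments.
Unset Strict Implicit.
Unset Printing Implicit Defensive.

Import GRing.Theory.

Local Open Scope nat_scope.

(* Sequences are indexed from 0 throughout: row i, column j and time t below
   are row i + 1, column j + 1 and time t + 1 in one-based notation. *)

(* Partitions differing only by trailing zeros are identified by taking the
   representative without zeros, so that its [size] is the length and its
   [sumn] the size of the partition; [nth 0 la i] is the (i + 1)-st part of the
   zero-padded sequence. *)
Definition is_partition (la : seq nat) : bool :=
  sorted geq la && (0 \notin la).

(* Removes the trailing zeros only: the result is a partition exactly when the
   given sequence is non-increasing. *)
Definition trim (s : seq nat) : seq nat :=
  foldr (fun x t => if (x == 0) && nilp t then [::] else x :: t) [::] s.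

Definition conj_part (la : seq nat) : seq nat :=
  mkseq (fun j => count (fun x => j < x) la) (head 0 la).

(* Elementwise sum of two sequences, both padded with zeros to length N. *)
Definition addseq (N : nat) (s t : seq nat) : seq nat :=
  mkseq (fun i => nth 0 s i + nth 0 t i) N.

Definition rho (n : nat) : seq nat := rev (iota 0 n).

Definition subseq_at (la K : seq nat) : seq nat := [seq nth 0 la k | k <- K].

(* A walk is the sequence of its steps: [true] is a south step, [false] a west
   step. It starts at the top-right corner of the rectangle of width n and
   height m, hence ends at the bottom-left corner iff it has n west steps and
   m south steps. *)
Definition staircase (n m : nat) : set (seq bool) :=
  [set w | count_mem false w = n /\ count_mem true w = m].

Definition vtimes (w : seq bool) : seq nat :=
  [seq t <- iota 0 (size w) | nth false w t].

Definition htimes (w : seq bool) : seq nat :=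
  [seq t <- iota 0 (size w) | ~~ nth false w t].

(* Distances to the left and to the top side of the rectangle after t steps. *)
Definition walk_x (n : nat) (w : seq bool) (t : nat) : nat :=
  n - count_mem false (take t w).

Definition walk_depth (w : seq bool) (t : nat) : nat :=
  count_mem true (take t w).

(* The box in row i from the top and column j from the left lies above the walk
   iff it lies to the left of a south step crossing row i, and below the walk
   iff it lies to the right of such a step. *)
Definition box_above (n : nat) (w : seq bool) (i j : nat) : bool :=
  has (fun t => (walk_depth w t == i) && (j < walk_x n w t)) (vtimes w).

Definition box_below (n : nat) (w : seq bool) (i j : nat) : bool :=
  has (fun t => (walk_depth w t == i) && (walk_x n w t <= j)) (vtimes w).

(* The row lengths of a set D of boxes (i, j) with i < m and j < n. *)
Definition row_lengths (m n : nat) (D : nat -> nat -> bool) : seq nat :=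
  trim (mkseq (fun i => count (D i) (iota 0 n)) m).

Definition walk_mu (n m : nat) (w : seq bool) : seq nat :=
  row_lengths m n (box_above n w).

Definition walk_nu (n m : nat) (w : seq bool) : seq nat :=
  row_lengths m n (fun i j => box_below n w (m.-1 - i) (n.-1 - j)).

Definition beta (m n : nat) (mu nu : seq nat) : seq nat :=
  addseq m mu (rho m) ++ addseq n nu (rho n).

Definition is_overlap (m n : nat) (mu nu la : seq nat) : Prop :=
  [/\ is_partition la, size la <= m + n
    & perm_eq (addseq (m + n) la (rho (m + n))) (beta m n mu nu)].

(* [None] stands for the symbol infinity. *)
Definition overlap (m n : nat) (mu nu : seq nat) : option (seq nat) :=
  if pselect (exists la, is_overlap m n mu nu la) is left e
  then Some (projT1 (cid e)) else None.

(* The permutation picked is unique, and the default 1 is never used: see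
   [overlap_signP] and [overlap_sort_ex]. *)
Definition overlap_sign (m n : nat) (mu nu : seq nat) : int :=
  if overlap m n mu nu is Some la then
    ((-1) ^+ odflt 1%g [pick s : 'S_(m + n) | [forall i : 'I_(m + n),
       nth 0%N (addseq (m + n) la (rho (m + n))) i
         == nth 0%N (beta m n mu nu) (s i)]])%R
  else 1%R.

Definition overlap_pairs (m n : nat) (la : seq nat) :
    set (seq nat * seq nat) :=
  [set p | [/\ is_partition p.1 && (size p.1 <= m),
               is_partition p.2 && (size p.2 <= n)
             & overlap m n p.1 p.2 = Some la]].

Definition walk_pair (n m : nat) (la : seq nat) (w : seq bool) :
    seq nat * seq nat :=
  (trim (addseq m (walk_mu n m w) (subseq_at la (vtimes w))),
   trim (addseq n (conj_part (walk_nu n m w)) (subseq_at la (htimes w)))).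

Lemma nth_trim s i : nth 0 (trim s) i = nth 0 s i.
Proof.
elim: s i => [|x s IHs] i //=; case: ifP => [/andP[/eqP-> /nilP s0]|_].
  by case: i => [|i] //=; rewrite -IHs s0 !nth_nil.
by case: i => [|i] /=.
Qed.

Lemma count_ltn_iota a n : a <= n -> count (fun j => j < a) (iota 0 n) = a.
Proof.
move=> le_an; rewrite -(subnKC le_an) iotaD count_cat add0n.
rewrite (eq_in_count (a2 := predT)) ?count_predT ?size_iota; last first.
  by move=> j; rewrite mem_iota => /andP[_ ->].
rewrite (eq_in_count (a2 := pred0)) ?count_pred0 ?addn0 // => j.
by rewrite mem_iota => /andP[le_aj _] /=; rewrite ltnNge le_aj.
Qed.

Lemma walk_south_step w i : i < count_mem true w ->
  exists2 t, t \in vtimes w & forall P : pred nat,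
    has (fun u => (walk_depth w u == i) && P u) (vtimes w) = P t.
Proof.
move=> lt_i.
have [t [lt_t wt dt]] :
    exists t, [/\ t < size w, nth false w t & walk_depth w t = i].
  rewrite /walk_depth; elim: w i lt_i => [|[] w IHw] [|i] //= lt_i.
  - by exists 0.
  - by have [t [lt_t wt dt]] := IHw i lt_i; exists t.+1; split; rewrite //= dt.
  - by have [t [lt_t wt dt]] := IHw 0 lt_i; exists t.+1; split; rewrite //= dt.
  - by have [t [lt_t wt dt]] := IHw i.+1 lt_i; exists t.+1; split; rewrite //= dt.
have t_in u : (u \in vtimes w) = nth false w u && (u < size w).
  by rewrite mem_filter mem_iota.
exists t => [|P]; first by rewrite t_in wt.
apply/hasP/idP => [[u]|Pt]; last by exists t; rewrite ?t_in ?wt ?dt ?eqxx.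
rewrite t_in => /andP[wu lt_u] /andP[/eqP du Pu].
suff /eqP<- : u == t by [].
have mono a b : a < b -> a < size w -> nth false w a ->
    walk_depth w a < walk_depth w b.
  move=> lt_ab lt_a wa; rewrite /walk_depth.
  rewrite -(subnKC lt_ab) takeD count_cat (take_nth false lt_a) wa.
  by rewrite -cats1 count_cat /= !addn1 leq_addr.
case: (ltngtP u t) => // lt_ut.
  by have := mono _ _ lt_ut lt_u wu; rewrite du dt ltnn.
by have := mono _ _ lt_ut lt_t wt; rewrite du dt ltnn.
Qed.

(* The Ferrers diagram of [walk_mu n m w] is the set of boxes above w. *)
Lemma walk_mu_diagram n m w i j : staircase n m w -> i < m -> j < n ->
  (j < nth 0 (walk_mu n m w) i) = box_above n w i j.
Proof.
move=> [_ <-] lt_i lt_j; rewrite nth_trim nth_mkseq //.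
have [t _ hasE] := walk_south_step lt_i.
have aE k : box_above n w i k = (k < walk_x n w t).
  exact: (hasE (fun u => k < walk_x n w u)).
by rewrite (eq_count aE) count_ltn_iota ?leq_subr // aE.
Qed.

(* The Ferrers diagram of [walk_nu n m w], rotated by 180 degrees, is the set
   of boxes below w. *)
Lemma walk_nu_diagram n m w i j : staircase n m w -> i < m -> j < n ->
  (j < nth 0 (walk_nu n m w) i) = box_below n w (m.-1 - i) (n.-1 - j).
Proof.
move=> [_ cw] lt_i lt_j; rewrite nth_trim nth_mkseq //.
have lt_i' : m.-1 - i < count_mem true w.
  by rewrite cw; case: (m) lt_i => // m' _; rewrite ltnS leq_subr.
have [t _ hasE] := walk_south_step lt_i'.
have bE k : k < n ->
    box_below n w (m.-1 - i) (n.-1 - k) = (k < n - walk_x n w t).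
  move=> lt_k; rewrite [LHS](hasE (fun u => walk_x n w u <= n.-1 - k)).
  have le_x : walk_x n w t <= n by rewrite leq_subr.
  case: (n) lt_k le_x => // n'; rewrite ltnS /= => le_k le_x.
  by rewrite ltn_subRL addnC -ltn_subRL subSn // ltnS.
rewrite (@eq_in_count _ _ (fun k => k < n - walk_x n w t)) => [|k].
  by rewrite count_ltn_iota ?leq_subr // bE.
by rewrite mem_iota => /andP[_ lt_k]; rewrite bE.
Qed.

Lemma addseq_rho_sorted N la : sorted geq la ->
  sorted gtn (addseq N la (rho N)).
Proof.
move=> la_s; apply/(sortedP 0) => i; rewrite size_mkseq => lt_i.
have lt_i' := ltnW lt_i; rewrite !nth_mkseq //.
rewrite /rho !nth_rev ?size_iota // !nth_iota ?add0n; last first.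
- by rewrite ltn_subrL /= (leq_ltn_trans _ lt_i).
- by rewrite ltn_subrL /= (leq_ltn_trans _ lt_i).
rewrite /= -addnS leq_add //; last by rewrite subnSK.
have [lt|ge] := ltnP i.+1 (size la); last by rewrite nth_default.
by move/(sortedP 0): la_s => /(_ _ lt).
Qed.

Lemma is_overlap_inj m n mu nu la la' :
  is_overlap m n mu nu la -> is_overlap m n mu nu la' -> la = la'.
Proof.
move=> [/andP[s1 z1] l1 p1] [/andP[s2 z2] l2 p2].
have gtn_tr : transitive gtn by move=> a b c /= ab bc; apply: ltn_trans ab.
have gtn_as : antisymmetric gtn.
  by move=> a b /andP[ab ba]; have := ltn_trans ab ba; rewrite /= ltnn.
have eq_s : addseq (m + n) la (rho (m + n)) = addseq (m + n) la' (rho (m + n)).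
  apply: (sorted_eq gtn_tr gtn_as); rewrite ?addseq_rho_sorted //.
  by rewrite (perm_trans p1) // perm_sym.
have eq_nth i : nth 0 la i = nth 0 la' i.
  have [lt|ge] := ltnP i (m + n); last first.
    by rewrite !nth_default //; [exact: leq_trans l2 _|exact: leq_trans l1 _].
  have := congr1 (fun s => nth 0 s i) eq_s; rewrite !nth_mkseq //.
  exact: addIn.
have size_le a b : 0 \notin a -> (forall i, nth 0 a i = nth 0 b i) ->
    size a <= size b.
  move=> za ab; rewrite leqNgt; apply/negP => lt; case/negP: za.
  by rewrite -[0](nth_default 0 (leqnn (size b))) -ab mem_nth.
by apply: (@eq_from_nth _ 0) => //; apply/eqP; rewrite eqn_leq !size_le.
Qed.

Lemma overlapP m n mu nu la :
  overlap m n mu nu = Some la <-> is_overlap m n mu nu la.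
Proof.
rewrite /overlap; case: pselect => [e|ne]; last first.
  by split=> // ol; case: ne; exists la.
split=> [[<-]|ol]; first by case: (cid e).
by case: (cid e) => l /= ol'; rewrite (is_overlap_inj ol ol').
Qed.

Lemma overlap_sort_ex m n mu nu la : overlap m n mu nu = Some la ->
  exists s : 'S_(m + n), forall i : 'I_(m + n),
    nth 0 (addseq (m + n) la (rho (m + n))) i = nth 0 (beta m n mu nu) (s i).
Proof.
move=> /overlapP[_ _]; have sb : size (beta m n mu nu) == m + n.
  by rewrite size_cat !size_mkseq.
move=> /(@tuple_permP _ _ _ (Tuple sb))[s ->]; exists s => i.
by rewrite -tnth_nth tnth_mktuple (tnth_nth 0).
Qed.

Lemma overlap_signP m n mu nu la (s : 'S_(m + n)) :
    overlap m n mu nu = Some la ->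
    (forall i : 'I_(m + n),
      nth 0 (addseq (m + n) la (rho (m + n))) i = nth 0 (beta m n mu nu) (s i)) ->
  overlap_sign m n mu nu = ((-1) ^+ s)%R.
Proof.
move=> ol sP; rewrite /overlap_sign ol; case: pickP => [s' /forallP s'P|/(_ s)].
  suff -> : s' = s by [].
  apply/permP => i; apply/val_inj/eqP.
  have sb : size (beta m n mu nu) = m + n by rewrite size_cat !size_mkseq.
  have ub : uniq (beta m n mu nu).
    have /overlapP[/andP[la_s _] _ /perm_uniq<-] := ol.
    apply: (@sorted_uniq _ gtn); last exact: addseq_rho_sorted.
      by move=> a b c /= ab bc; apply: ltn_trans ab.
    by move=> a; rewrite /= ltnn.
  by rewrite -(nth_uniq 0 _ _ ub) ?sb ?ltn_ord // -(eqP (s'P i)) sP.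
by case/forallP=> i; rewrite sP.
Qed.

(* Main.v *)
(* Write L for the strictly decreasing sequence lambda + rho_{m+n}. Row i of
   mu(pi) is n minus the number of west steps before the i-th south step, so
   mu(pi) + lambda_V + rho_m is just L_V; dually nu(pi)' + lambda_H + rho_n is
   L_H. Overlaps equal to lambda are thus the ways of splitting L into an
   m-element and an n-element subsequence, i.e. the words with m south and n
   west steps. The sorting permutation is the shuffle V ++ H, whose inversions
   are the pairs (west step, later south step), i.e. the boxes below pi. *)

Require Import Defs.
From mathcomp Require Import all_boot all_order all_fingroup all_algebra.
From mathcomp Require Import boolp classical_sets functions.
From mathcomp Require Import zify.

Set Implicit Arguments.
Unset Strict Implicit.
Unset Printing Implicit Defensive.

Local Open Scope nat_scope.

(** * Trimming, conjugates and the shift by the staircase [rho] *)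

Lemma size_trim s : size (trim s) <= size s.
Proof. by elim: s => //= x s IHs; case: ifP. Qed.

Lemma count_trim (P : pred nat) s : ~~ P 0 -> count P (trim s) = count P s.
Proof.
move=> /negbTE P0; elim: s => //= x s <-.
by case: ifP => //= /andP[/eqP-> /nilP->]; rewrite P0.
Qed.

Lemma sumn_trim s : sumn (trim s) = sumn s.
Proof. by elim: s => //= x s <-; case: ifP => //= /andP[/eqP-> /nilP->]. Qed.

Lemma trim_zeros s : all (pred1 0) s -> trim s = [::].
Proof. by elim: s => //= x s IHs /andP[/eqP-> /IHs->]. Qed.

Lemma geq_trans : transitive geq.
Proof. by move=> a b c /= ab bc; apply: leq_trans ab. Qed.

Lemma gtn_trans : transitive gtn.
Proof. by move=> a b c /= ab bc; apply: ltn_trans ab. Qed.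

Lemma gtn_anti : antisymmetric gtn.
Proof. by move=> a b /andP[/= ab ba]; lia. Qed.

(** In a non-increasing sequence only zeros can follow a zero, so removing the trailing zeros
    removes all of them. *)
Lemma is_partition_trim s : sorted geq s -> is_partition (trim s).
Proof.
move=> s_s; apply/andP; split.
  apply/(sortedP 0) => i lt; rewrite !nth_trim.
  by move/(sortedP 0): s_s; apply; apply: leq_trans lt (size_trim s).
elim: s s_s => //= x s IHs; rewrite path_sortedE; last exact: geq_trans.
move=> /andP[/allP x_s /IHs t0]; have [x0|x_neq0] := eqVneq x 0.
  rewrite trim_zeros //; apply/allP => y /x_s /=; lia.
by rewrite inE negb_or eq_sym x_neq0.
Qed.

Lemma partition_eq p q : 0 \notin p -> 0 \notin q ->
  nth 0 p =1 nth 0 q -> p = q.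
Proof.
have size_le a b : 0 \notin a -> nth 0 a =1 nth 0 b -> size a <= size b.
  move=> za ab; rewrite leqNgt; apply/negP => lt; case/negP: za.
  by rewrite -[0](nth_default 0 (leqnn (size b))) -ab mem_nth.
move=> p0 q0 pq; apply: (@eq_from_nth _ 0) => //.
by apply/eqP; rewrite eqn_leq !size_le.
Qed.

(** Past the first part, which is the largest, both sides are 0. *)
Lemma nth_conj_part la j : sorted geq la ->
  nth 0 (conj_part la) j = count (fun x => j < x) la.
Proof.
move=> la_s; have [lt|ge] := ltnP j (head 0 la); first by rewrite nth_mkseq.
rewrite nth_default ?size_mkseq //; apply/esym/eqP.
rewrite -leqn0 leqNgt -has_count; apply/hasPn => x x_la; rewrite -leqNgt.
apply: leq_trans ge; case: la la_s x_la => //= y la.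
rewrite path_sortedE; last exact: geq_trans.
move=> /andP[/allP yla _].
by rewrite inE => /orP[/eqP->|/yla].
Qed.

Lemma nth_rho k i : i < k -> nth 0 (rho k) i = k - i.+1.
Proof.
by move=> lt; rewrite nth_rev size_iota // nth_iota ?add0n //; lia.
Qed.

Lemma nth_addseq N s t i : i < N ->
  nth 0 (addseq N s t) i = nth 0 s i + nth 0 t i.
Proof. exact: nth_mkseq. Qed.

Lemma addseq_rho_inj k p q : is_partition p -> is_partition q ->
  size p <= k -> size q <= k ->
  addseq k p (rho k) = addseq k q (rho k) -> p = q.
Proof.
move=> /andP[_ p0] /andP[_ q0] lp lq E; apply: partition_eq => // i.
have [lt|ge] := ltnP i k; last by rewrite !nth_default //; lia.
by have := congr1 (nth 0 ^~ i) E; rewrite !nth_addseq //; apply: addIn.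
Qed.

(** Consecutive entries of [rho k] differ by exactly 1, so strict decrease after the shift is weak
    decrease before it. *)
Lemma addseq_rho_sortedV k s : size s <= k ->
  sorted gtn (addseq k s (rho k)) -> sorted geq s.
Proof.
move=> le_s /(sortedP 0) S; apply/(sortedP 0) => i lt_i /=.
have := S i; rewrite size_mkseq !nth_addseq ?nth_rho /=; lia.
Qed.

Lemma trim_addseq_rho k s : addseq k (trim s) (rho k) = addseq k s (rho k).
Proof.
apply: (@eq_from_nth _ 0) => [|i]; rewrite !size_mkseq // => lt.
by rewrite !nth_addseq // nth_trim.
Qed.

(** * Step times, and the west steps that precede each south step *)

Lemma vtimes_cons b w :
  vtimes (b :: w) = (if b then cons 0 else id) (map S (vtimes w)).
Proof.
rewrite /vtimes /= (iotaDl 1 0) filter_map /=.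
by case: b; rewrite /= ?(eq_map (g := S)).
Qed.

Lemma htimes_cons b w :
  htimes (b :: w) = (if b then id else cons 0) (map S (htimes w)).
Proof.
rewrite /htimes /= (iotaDl 1 0) filter_map /=.
by case: b; rewrite /= ?(eq_map (g := S)).
Qed.

Lemma size_vtimes w : size (vtimes w) = count_mem true w.
Proof.
by elim: w => // b w; rewrite vtimes_cons; case: b; rewrite /= size_map => ->.
Qed.

Lemma size_htimes w : size (htimes w) = count_mem false w.
Proof.
by elim: w => // b w; rewrite htimes_cons; case: b; rewrite /= size_map => ->.
Qed.

Lemma perm_vtimes_htimes w :
  perm_eq (iota 0 (size w)) (vtimes w ++ htimes w).
Proof. rewrite perm_sym; apply/permPl; exact: perm_filterC. Qed.

Lemma mem_vtimes w t : t < size w -> (t \in vtimes w) = nth false w t.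
Proof. by move=> lt; rewrite mem_filter mem_iota /= lt andbT. Qed.

Lemma sorted_vtimes w : sorted ltn (vtimes w).
Proof. exact: (sorted_filter ltn_trans) (iota_ltn_sorted _ _). Qed.

Lemma sorted_htimes w : sorted ltn (htimes w).
Proof. exact: (sorted_filter ltn_trans) (iota_ltn_sorted _ _). Qed.

Lemma size_count_bool w : size w = count_mem true w + count_mem false w.
Proof. by elim: w => // [[]] w /= ->; lia. Qed.

(** One list encodes both diagrams: its complement in [n] gives the rows above the walk, its
    reversal the rows below. It satisfies a simple recursion on the first step, which drives the
    inductions that follow. *)
Definition wests_before (w : seq bool) : seq nat :=
  [seq count_mem false (take t w) | t <- vtimes w].

Lemma wests_before_cons b w : wests_before (b :: w) =
  if b then 0 :: wests_before w else map S (wests_before w).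
Proof.
by rewrite /wests_before vtimes_cons; case: b => /=; rewrite -!map_comp.
Qed.

Lemma size_wests_before w : size (wests_before w) = count_mem true w.
Proof. by rewrite size_map size_vtimes. Qed.

Lemma wests_before_le w i : nth 0 (wests_before w) i <= count_mem false w.
Proof.
elim: w i => [|[] w IHw] i; first by rewrite nth_nil.
  by rewrite wests_before_cons; case: i => [|i] //=; exact: IHw.
rewrite wests_before_cons /= add1n.
have [lt|ge] := ltnP i (size (wests_before w)).
  by rewrite (nth_map 0) ?ltnS ?IHw.
by rewrite nth_default // (size_map S).
Qed.

Lemma sorted_wests_before w : sorted leq (wests_before w).
Proof.
elim: w => // [[]] w IHw; rewrite wests_before_cons.
  by rewrite /= (path_sortedE leq_trans) IHw andbT; apply/allP.
by rewrite sorted_map.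
Qed.

(** The steps before south step [i] are [i] south steps and the west steps counted by
    [wests_before]. *)
Lemma nth_vtimes w i : i < count_mem true w ->
  nth 0 (vtimes w) i = nth 0 (wests_before w) i + i.
Proof.
elim: w i => [|b w IHw] i //; rewrite vtimes_cons wests_before_cons.
case: b => /=; rewrite ?add1n ?add0n.
  case: i => [|i] //= lt.
  by rewrite (nth_map 0) ?size_vtimes // IHw // addnS.
by move=> lt; rewrite !(nth_map 0 0 S) ?size_vtimes ?size_wests_before // IHw.
Qed.

(** The count is the number of south steps after west step [j], while the time of that step is [j]
    plus the number of south steps before it. The additive form avoids truncated subtraction. *)
Lemma nth_htimes w j : j < count_mem false w ->
  count (fun x => j < x) (wests_before w) + nth 0 (htimes w) j
    = count_mem true w + j.
Proof.
elim: w j => [|b w IHw] j //; rewrite htimes_cons wests_before_cons.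
case: b => /=; rewrite ?add1n ?add0n => lt.
  by rewrite (nth_map 0) ?size_htimes // addnS IHw.
rewrite count_map; case: j lt => [|j] lt /=.
  by rewrite (eq_count (a2 := predT)) // count_predT size_wests_before.
by rewrite (nth_map 0) ?size_htimes // addnS IHw // addnS.
Qed.

(** * The diagrams above and below a walk *)

Lemma walk_depth_vtimes w i : i < count_mem true w ->
  walk_depth w (nth 0 (vtimes w) i) = i.
Proof.
rewrite /walk_depth; elim: w i => [|b w IHw] i //.
rewrite vtimes_cons; case: b => /=; rewrite ?add1n ?add0n.
  by case: i => [|i] //= lt; rewrite (nth_map 0) ?size_vtimes //= IHw.
by move=> lt; rewrite (nth_map 0) ?size_vtimes //= IHw.
Qed.

Lemma has_south_step w i (P : pred nat) : i < count_mem true w ->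
  has (fun u => (walk_depth w u == i) && P u) (vtimes w)
    = P (nth 0 (vtimes w) i).
Proof.
move=> lt; have [t _ hasE] := walk_south_step lt.
(* Applying [hasE] to the predicate of being the [i]-th south time reduces the identification of [t]
   to exhibiting that time. *)
rewrite hasE; congr P; apply/eqP; rewrite -[_ == _]/(pred1 _ t) -hasE.
apply/hasP; exists (nth 0 (vtimes w) i); first by rewrite mem_nth ?size_vtimes.
by rewrite walk_depth_vtimes //= !eqxx.
Qed.

Lemma walk_x_vtimes n w i : i < count_mem true w ->
  walk_x n w (nth 0 (vtimes w) i) = n - nth 0 (wests_before w) i.
Proof. by move=> lt; rewrite (nth_map 0) ?size_vtimes. Qed.

Lemma walk_muE n m w : staircase n m w ->
  walk_mu n m w = trim [seq n - x | x <- wests_before w].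
Proof.
move=> [_ cw]; congr trim; apply: (@eq_from_nth _ 0) => [|i].
  by rewrite size_mkseq size_map size_wests_before.
rewrite size_mkseq => lt; rewrite nth_mkseq // (nth_map 0) ?size_wests_before ?cw //.
rewrite (eq_count (a2 := fun j => j < n - nth 0 (wests_before w) i)).
  by rewrite count_ltn_iota ?leq_subr.
move=> j; rewrite -walk_x_vtimes ?cw //.
by apply: (has_south_step (fun u => j < walk_x n w u)); rewrite cw.
Qed.

Lemma walk_nuE n m w : staircase n m w ->
  walk_nu n m w = trim (rev (wests_before w)).
Proof.
move=> [cf cw]; congr trim; apply: (@eq_from_nth _ 0) => [|i].
  by rewrite size_mkseq size_rev size_wests_before.
rewrite size_mkseq => lt; rewrite nth_mkseq //.
rewrite nth_rev size_wests_before cw //.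
(* The left side is the row index after the rotation, the right side the index produced by
   [nth_rev]. *)
have -> : m.-1 - i = m - i.+1 by lia.
have lt' : m - i.+1 < count_mem true w by lia.
have le_n := wests_before_le w (m - i.+1).
rewrite (@eq_in_count _ _ (fun j => j < nth 0 (wests_before w) (m - i.+1))).
  by rewrite count_ltn_iota -?cf.
move=> j; rewrite mem_iota => /andP[_ lt_j].
rewrite [LHS](has_south_step (fun u => walk_x n w u <= n.-1 - j)) //.
rewrite walk_x_vtimes //; lia.
Qed.

Lemma sumn_walk_nu n m w : staircase n m w ->
  sumn (walk_nu n m w) = sumn (wests_before w).
Proof. by move=> sw; rewrite (walk_nuE sw) sumn_trim sumn_rev. Qed.

(** Each south step contributes [n - x] to one size and [x] to the other, with [x <= n]. *)
Lemma sumn_walk_mu n m w : staircase n m w ->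
  sumn (walk_mu n m w) + sumn (walk_nu n m w) = m * n.
Proof.
move=> sw; rewrite sumn_walk_nu // walk_muE // sumn_trim.
have [cf <-] := sw; rewrite -size_wests_before.
have /allP : {in wests_before w, forall x, x <= n}.
  by move=> x /(nthP 0)[i _ <-]; rewrite -cf wests_before_le.
by elim: (wests_before w) => //= x s IHs /andP[le /IHs]; lia.
Qed.

Lemma nth_conj_walk_nu n m w j : staircase n m w -> j < n ->
  nth 0 (conj_part (walk_nu n m w)) j + nth 0 (htimes w) j = m + j.
Proof.
move=> sw lt; have [cf cw] := sw; rewrite walk_nuE // nth_conj_part.
  by rewrite count_trim // count_rev nth_htimes ?cf ?cw.
have /andP[//] : is_partition (trim (rev (wests_before w))).
by apply: is_partition_trim; rewrite rev_sorted sorted_wests_before.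
Qed.

(** * The pair of a walk as two subsequences of the shifted partition *)

Lemma staircase_size n m w : staircase n m w -> size w = m + n.
Proof. by move=> [<- <-]; exact: size_count_bool. Qed.

Lemma vtimes_lt w i : i < count_mem true w -> nth 0 (vtimes w) i < size w.
Proof.
rewrite -size_vtimes => /(mem_nth 0).
by rewrite mem_filter mem_iota => /andP[_ /andP[_]].
Qed.

Lemma htimes_lt w i : i < count_mem false w -> nth 0 (htimes w) i < size w.
Proof.
rewrite -size_htimes => /(mem_nth 0).
by rewrite mem_filter mem_iota => /andP[_ /andP[_]].
Qed.

Local Notation shifted N la := (addseq N la (rho N)).

(** With [x] west steps before south step [i], the time is [x + i], and [(n - x) + (m - i.+1)] is
    exactly the entry of [rho (m + n)] at that time. *)
Lemma walk_pair_mu m n la w : staircase n m w ->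
  addseq m (walk_pair n m la w).1 (rho m)
    = [seq nth 0 (shifted (m + n) la) t | t <- vtimes w].
Proof.
move=> sw; have [cf cw] := sw; rewrite trim_addseq_rho.
apply: (@eq_from_nth _ 0) => [|i].
  by rewrite size_mkseq size_map size_vtimes.
rewrite size_mkseq => lt; have lt' : i < count_mem true w by rewrite cw.
have ltV := vtimes_lt lt'; rewrite (staircase_size sw) in ltV.
rewrite [RHS](nth_map 0) ?size_vtimes // !nth_addseq // !nth_rho //.
rewrite [nth 0 (subseq_at _ _) _](nth_map 0) ?size_vtimes //.
rewrite walk_muE // nth_trim (nth_map 0) ?size_wests_before //.
have := wests_before_le w i; have := nth_vtimes lt'; rewrite cf; lia.
Qed.

(** By [nth_conj_walk_nu], part [j] of the conjugate plus [n - j.+1] is the entry of [rho (m + n)]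
    at the time of west step [j]. *)
Lemma walk_pair_nu m n la w : staircase n m w ->
  addseq n (walk_pair n m la w).2 (rho n)
    = [seq nth 0 (shifted (m + n) la) t | t <- htimes w].
Proof.
move=> sw; have [cf cw] := sw; rewrite trim_addseq_rho.
apply: (@eq_from_nth _ 0) => [|i].
  by rewrite size_mkseq size_map size_htimes.
rewrite size_mkseq => lt; have lt' : i < count_mem false w by rewrite cf.
have ltV := htimes_lt lt'; rewrite (staircase_size sw) in ltV.
rewrite [RHS](nth_map 0) ?size_htimes // !nth_addseq // !nth_rho //.
rewrite [nth 0 (subseq_at _ _) _](nth_map 0) ?size_htimes //.
have := nth_conj_walk_nu sw lt; lia.
Qed.

Lemma beta_walk_pair m n la w : staircase n m w ->
  beta m n (walk_pair n m la w).1 (walk_pair n m la w).2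
    = [seq nth 0 (shifted (m + n) la) t | t <- vtimes w ++ htimes w].
Proof. by move=> sw; rewrite /beta walk_pair_mu ?walk_pair_nu ?map_cat. Qed.

(** * The bijection between walks and overlap pairs *)

Lemma shifted_uniq N la : sorted geq la -> uniq (shifted N la).
Proof.
move=> la_s; apply: (@sorted_uniq _ gtn); first exact: gtn_trans.
  by move=> a; rewrite /= ltnn.
exact: addseq_rho_sorted.
Qed.

Lemma sorted_map_shifted N la s : sorted geq la -> sorted ltn s ->
  {subset s <= iota 0 N} -> sorted gtn [seq nth 0 (shifted N la) t | t <- s].
Proof.
move=> la_s s_s sub; rewrite sorted_map.
apply: (sub_in_sorted (P := mem (iota 0 N))) s_s; last exact/allP.
move=> x y; rewrite !mem_iota /= !add0n => x_lt y_lt lt_xy.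
have gt_s := addseq_rho_sorted N la_s.
by apply: (sorted_ltn_nth gtn_trans 0 gt_s) => //; rewrite inE size_mkseq.
Qed.

Lemma walk_pair_in m n la w : is_partition la -> size la <= m + n ->
  staircase n m w -> overlap_pairs m n la (walk_pair n m la w).
Proof.
move=> la_part la_len sw; have szw := staircase_size sw.
have /andP[la_s _] := la_part.
(* Both components are trimmed sequences of prescribed length, so being partitions follows from
   strict decrease after the shift, inherited from [shifted (m + n) la]. *)
have part_trim k s : size s = k ->
    sorted gtn (addseq k (trim s) (rho k)) ->
    is_partition (trim s) && (size (trim s) <= k).
  rewrite trim_addseq_rho => <- /(addseq_rho_sortedV (leqnn _)) s_s.
  by rewrite is_partition_trim ?s_s // size_trim.
split.
- apply: part_trim; rewrite ?size_mkseq // [X in sorted _ X]walk_pair_mu //.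
  apply: (sorted_map_shifted la_s (sorted_vtimes w)) => t.
  by rewrite mem_filter szw => /andP[].
- apply: part_trim; rewrite ?size_mkseq // [X in sorted _ X]walk_pair_nu //.
  apply: (sorted_map_shifted la_s (sorted_htimes w)) => t.
  by rewrite mem_filter szw => /andP[].
apply/overlapP; split=> //; rewrite beta_walk_pair //.
rewrite -{1}[shifted _ _](mkseq_nth 0) size_mkseq -szw.
exact/perm_map/perm_vtimes_htimes.
Qed.

(** The entries of the shifted partition are distinct, so the values in the first component reveal
    the times of the south steps. This left inverse yields injectivity. *)
Lemma walk_of_pair m n la w : sorted geq la -> staircase n m w ->
  w = [seq x \in addseq m (walk_pair n m la w).1 (rho m)
         | x <- shifted (m + n) la].
Proof.
move=> la_s sw; have szw := staircase_size sw; rewrite walk_pair_mu //.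
apply: (@eq_from_nth _ false) => [|t]; first by rewrite size_map size_mkseq.
move=> lt; rewrite (nth_map 0) ?size_mkseq -?szw // -mem_vtimes //.
apply/idP/mapP => [tV|[u]]; first by exists t.
rewrite mem_filter mem_iota => /and3P[wu _ lt_u] /eqP.
rewrite nth_uniq ?size_mkseq -?szw ?shifted_uniq // mem_vtimes //.
by move=> /eqP->.
Qed.

Lemma walk_pair_inj m n la w w' : sorted geq la ->
  staircase n m w -> staircase n m w' ->
  walk_pair n m la w = walk_pair n m la w' -> w = w'.
Proof.
by move=> la_s sw sw' E; rewrite (walk_of_pair la_s sw) E -walk_of_pair.
Qed.

Lemma walk_pair_surj m n la mu nu : is_partition la -> size la <= m + n ->
  overlap_pairs m n la (mu, nu) ->
  exists2 w, staircase n m w & walk_pair n m la w = (mu, nu).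
Proof.
move=> la_part la_len [/= /andP[mu_p mu_l] /andP[nu_p nu_l] /overlapP[_ _]].
have /andP[la_s _] := la_part.
rewrite /beta; set L := shifted _ _; set A := addseq m mu _; set B := addseq n nu _ => pL.
have sA : sorted gtn A by case/andP: mu_p => s _; exact: addseq_rho_sorted.
have sB : sorted gtn B by case/andP: nu_p => s _; exact: addseq_rho_sorted.
have uAB : uniq (A ++ B) by rewrite -(perm_uniq pL) shifted_uniq.
(* The only possible preimage, by [walk_of_pair]. *)
pose w := [seq x \in A | x <- L].
(* Selecting entries of [L] is turned into selecting positions, the form in which [vtimes] and
   [htimes] are defined. *)
have L_iota (P : pred nat) :
    [seq x <- L | P x] = [seq nth 0 L t | t <- iota 0 (size w) & P (nth 0 L t)].
  by rewrite size_map -[X in filter _ X](mkseq_nth 0) filter_map.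
(* Both sides are strictly decreasing, so agreement up to reordering suffices; no entry of [B]
   survives the filter because [A ++ B] has no repetition. *)
have AE : [seq x <- L | x \in A] = A.
  apply: (sorted_eq gtn_trans gtn_anti) => //.
    exact: sorted_filter gtn_trans _ _ (addseq_rho_sorted _ la_s).
  rewrite (perm_trans (perm_filter _ pL)) // filter_cat.
  move: uAB; rewrite cat_uniq => /and3P[_ /hasPn nB _].
  rewrite (eq_in_filter (a2 := predT)) ?filter_predT //.
  rewrite (eq_in_filter (a2 := pred0)) ?filter_pred0 ?cats0 // => x /nB.
  by move/negbTE.
have BE : [seq x <- L | x \notin A] = B.
  apply: (sorted_eq gtn_trans gtn_anti) => //.
    exact: sorted_filter gtn_trans _ _ (addseq_rho_sorted _ la_s).
  rewrite (perm_trans (perm_filter _ pL)) // filter_cat.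
  move: uAB; rewrite cat_uniq => /and3P[_ /hasPn nB _].
  rewrite (eq_in_filter (a2 := pred0)) ?filter_pred0 ?cat0s; last first.
    by move=> x /= ->.
  by rewrite (eq_in_filter (a2 := predT)) ?filter_predT // => x /nB.
have wE t : t < size w -> nth false w t = (nth 0 L t \in A).
  by rewrite size_map => lt; rewrite (nth_map 0).
have VA : [seq nth 0 L t | t <- vtimes w] = A.
  rewrite -[RHS]AE L_iota; congr map; apply: eq_in_filter => t.
  by rewrite mem_iota => /andP[_ /wE].
have HB : [seq nth 0 L t | t <- htimes w] = B.
  rewrite -[RHS]BE L_iota; congr map; apply: eq_in_filter => t.
  by rewrite mem_iota => /andP[_ /wE->].
(* The numbers of south and west steps are the lengths of [A] and [B]. *)
have sw : staircase n m w.
  have := congr1 size VA; have := congr1 size HB.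
  by rewrite !size_map !size_iota size_vtimes size_htimes.
exists w => //; have [] := walk_pair_in la_part la_len sw.
have := walk_pair_nu la sw; have := walk_pair_mu la sw.
case: (walk_pair n m la w) => mu' nu' /=; rewrite VA HB => Emu Enu.
move=> /andP[p1 l1] /andP[p2 l2] _.
by congr (_, _); [exact: addseq_rho_inj Emu | exact: addseq_rho_inj Enu].
Qed.

(** * The sign of the sorting permutation *)

(** [bump] skips the position of the inserted [x], as [lift] does on ordinals; this serves a first
    step west, whose time 0 is inserted after all south times. *)
Lemma nth_cat_cons_bump (s1 s2 : seq nat) x k :
  nth 0 (s1 ++ x :: s2) (bump (size s1) k) = nth 0 (s1 ++ s2) k.
Proof.
rewrite !nth_cat /bump; have [le|lt] := leqP (size s1) k.
  by rewrite add1n ltnNge leqW //= subSn // ltnNge le.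
by rewrite add0n lt.
Qed.

(* A first step south sends position 0 to 0, a first step west sends it past
   all the south steps; [odd_lift_perm] then counts the inversions. *)
Lemma shuffle_perm w : exists2 s : 'S_(size w),
    s = odd (sumn (wests_before w)) :> bool
  & forall i, nth 0 (vtimes w ++ htimes w) (s i) = i.
Proof.
elim: w => [|b w [s s_odd sP]]; first by exists 1%g; [exact: odd_perm1|case].
have nthS k : nth 0 (map S (vtimes w) ++ map S (htimes w)) (s k) = k.+1.
  rewrite -map_cat (nth_map 0) ?sP // -(perm_size (perm_vtimes_htimes w)).
  by rewrite size_iota.
rewrite wests_before_cons vtimes_cons htimes_cons; case: b => /=.
  exists (lift_perm ord0 ord0 s); first by rewrite odd_lift_perm.
  move=> i; case: (unliftP ord0 i) => [k|] ->; last by rewrite lift_perm_id.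
  by rewrite lift_perm_lift /= nthS.
have lt_m : count_mem true w < (size w).+1 by rewrite ltnS count_size.
exists (lift_perm ord0 (Ordinal lt_m) s).
  rewrite odd_lift_perm s_odd /= -size_wests_before -oddD; congr odd.
  by elim: (wests_before w) => //= x t; lia.
move=> i; have szV : size (map S (vtimes w)) = count_mem true w.
  by rewrite size_map size_vtimes.
case: (unliftP ord0 i) => [k|] ->.
  by rewrite lift_perm_lift /= -szV nth_cat_cons_bump nthS.
by rewrite lift_perm_id /= -szV nth_cat ltnn subnn.
Qed.

Lemma overlap_sign_walk_pair m n la w :
  is_partition la -> size la <= m + n -> staircase n m w ->
  overlap_sign m n (walk_pair n m la w).1 (walk_pair n m la w).2
    = ((-1) ^+ sumn (walk_nu n m w))%R.
Proof.
move=> la_part la_len sw; have [_ _ ol] := walk_pair_in la_part la_len sw.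
(* The existence statement is carried from [size w] to [m + n], since the two permutation types are
   not convertible. *)
have [s s_odd sP] : exists2 s : 'S_(m + n),
    s = odd (sumn (wests_before w)) :> bool
  & forall i, nth 0 (vtimes w ++ htimes w) (s i) = i.
  by rewrite -(staircase_size sw); exact: shuffle_perm.
rewrite (overlap_signP (s := s) ol) => [|i].
  by rewrite s_odd GRing.signr_odd (sumn_walk_nu sw).
rewrite beta_walk_pair // (nth_map 0) ?sP //.
by rewrite -(perm_size (perm_vtimes_htimes w)) size_iota (staircase_size sw).
Qed.

Theorem proposition4p3 (m n : nat) (la : seq nat)
    (la_part : is_partition la) (la_len : size la <= m + n) :
  set_bij (staircase n m) (overlap_pairs m n la) (walk_pair n m la) /\
  (forall w : seq bool, staircase n m w ->
     overlap_sign m n (walk_pair n m la w).1 (walk_pair n m la w).2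
       = ((-1) ^+ sumn (walk_nu n m w))%R
     /\ ((-1 : int) ^+ sumn (walk_nu n m w))%R
       = ((-1) ^+ (m * n - sumn (walk_mu n m w))%N)%R).
Proof.
have /andP[la_s _] := la_part.
split=> [|w sw]; last first.
  split; first exact: overlap_sign_walk_pair.
  by rewrite -(sumn_walk_mu sw) addKn.
split.
- by move=> w; exact: walk_pair_in.
- by move=> w w' /set_mem sw /set_mem sw'; exact: (walk_pair_inj la_s).
- by move=> [mu nu] /(walk_pair_surj la_part la_len)[w sw <-]; exists w.
Qed.
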